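(* Let $A$ be a $C^*$-algebra. (a) All commutators $[a,b]$ ($a,b\in A$) belong to $\mathrm{CQ}(A)$. In particular, $\mathrm{CQ}(A)=Z(A)$ if and only if $A$ is abelian. (b) All quasi-nilpotent elements of $A$ belong to $\mathrm{CQ}(A)$. Moreover, if $a\in A$ is quasi-nilpotent, then $ab,ba\in\mathrm{CQ}(A)$ for any $b\in A$.
   Context: $A$ is not assumed unital. ''Ideal'' means closed two-sided ideal; $Z(A)$ is the centre of $A$. An element $a\in A$ is a CQ-element of $A$ if for every ideal $I$ of $A$, $a+I\in Z(A/I)$ implies $a\in Z(A)+I$; $\mathrm{CQ}(A)$ is the set of all CQ-elements of $A$. $[a,b]=ab-ba$ up to sign convention (the paper writes $[x,y]$ for the commutator $xy-yx$). An element $a$ is quasi-nilpotent if its spectral radius $\lim_n\|a^n\|^{1/n}$ is $0$. *)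

(* Defs.v *)
From HB Require Import structures.
From mathcomp Require Import all_boot all_order all_algebra.
From mathcomp Require Import all_classical all_reals all_analysis.
From mathcomp Require Export complex.

Set Implicit Arguments.
Unset Strict Implicit.
Unset Printing Implicit Defensive.

Import Order.TTheory GRing.Theory Num.Theory.
Import numFieldNormedType.Exports.

Local Open Scope classical_set_scope.
Local Open Scope ring_scope.
Local Open Scope complex_scope.

(* A C*-algebra is not required to have a unit, so the multiplication is not
   that of the (unital) ring hierarchy: it is a separate operation [cmul].
   The norm of a normed module over [R[i]] takes its values in [R[i]]. *)
HB.mixin Record CompleteNormedModule_isCStarAlgebra (R : realType) A
    & CompleteNormedModule R[i] A := {
  cmul : A -> A -> A ;
  cstar : A -> A ;
  cmulA : forall x y z, cmul x (cmul y z) = cmul (cmul x y) z ;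
  cmulDl : forall x y z, cmul (x + y) z = cmul x z + cmul y z ;
  cmulDr : forall x y z, cmul x (y + z) = cmul x y + cmul x z ;
  cmulZl : forall (l : R[i]) x y, cmul (l *: x) y = l *: cmul x y ;
  cmulZr : forall (l : R[i]) x y, cmul x (l *: y) = l *: cmul x y ;
  cstarK : forall x, cstar (cstar x) = x ;
  cstarD : forall x y, cstar (x + y) = cstar x + cstar y ;
  cstarZ : forall (l : R[i]) x, cstar (l *: x) = l^*%C *: cstar x ;
  cstarM : forall x y, cstar (cmul x y) = cmul (cstar y) (cstar x) ;
  cnormM : forall x y, `|cmul x y| <= `|x| * `|y| ;
  cnorm_star_mul : forall x, `|cmul (cstar x) x| = `|x| ^+ 2
}.

#[short(type="cstarAlgType")]
HB.structure Definition CStarAlgebra (R : realType) :=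
  {A of CompleteNormedModule R[i] A & CompleteNormedModule_isCStarAlgebra R A}.

Declare Scope cstar_scope.
Delimit Scope cstar_scope with CS.
Notation "x ** y" := (cmul x y) (at level 40, left associativity) : cstar_scope.
Local Open Scope cstar_scope.

Definition ccommutator (R : realType) (A : cstarAlgType R) (x y : A) : A :=
  x ** y - y ** x.

Definition cabelian (R : realType) (A : cstarAlgType R) : Prop :=
  forall x y : A, x ** y = y ** x.

Definition ccenter (R : realType) (A : cstarAlgType R) : set A :=
  [set z | forall x : A, z ** x = x ** z].

Record closed_ideal (R : realType) (A : cstarAlgType R) (I : set A) : Prop := {
  ideal0 : I 0 ;
  idealD : forall x y, I x -> I y -> I (x + y) ;
  idealZ : forall (l : R[i]) x, I x -> I (l *: x) ;
  idealMl : forall x y, I y -> I (x ** y) ;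
  idealMr : forall x y, I x -> I (x ** y) ;
  ideal_closed : closed I
}.

Section Quotient.
Variables (R : realType) (A : cstarAlgType R).
Implicit Types (I : set A) (X Y : set A) (a b : A).

(* The elements of A/I are represented by the cosets themselves. *)
Definition ccoset I a : set A := [set a + i | i in I].

Definition cquotient I : set (set A) := range (ccoset I).

Definition quot_mul I X Y : set A :=
  [set c | exists x y i, [/\ X x, Y y, I i & c = x ** y + i]].

Definition quot_center I : set (set A) :=
  [set X | cquotient I X /\
    forall Y, cquotient I Y -> quot_mul I X Y = quot_mul I Y X].

Lemma quot_mul_coset I a b : closed_ideal I ->
  quot_mul I (ccoset I a) (ccoset I b) = ccoset I (a ** b).
Proof.
case=> I0 ID _ IMl IMr _; apply/seteqP; split=> c /=.
- move=> [x [y [k [[i Ii <-] [j Ij <-] Ik ->]]]].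
  exists (a ** j + i ** (b + j) + k).
    by apply: (ID) => //; apply: (ID); [exact: IMl|exact: IMr].
  by rewrite (cmulDl a i) (cmulDr a b) !addrA.
- move=> [k Ik <-]; exists a, b, k; split=> //.
  + by exists 0; rewrite ?addr0.
  + by exists 0; rewrite ?addr0.
Qed.

End Quotient.

Definition CQ (R : realType) (A : cstarAlgType R) : set A :=
  [set a | forall I : set A, closed_ideal I ->
    quot_center I (ccoset I a) ->
    exists z i, [/\ ccenter z, I i & a = z + i]].

Arguments ccenter {R} A.
Arguments CQ {R} A.

(* [cpowS a n] is the power a^(n+1); there is no 0-th power without a unit. *)
Definition cpowS (R : realType) (A : cstarAlgType R) (a : A) (n : nat) : A :=
  iter n (cmul a) a.

(* Norms are nonnegative reals inside [R[i]]; [complex.Re] brings them to [R]. *)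
Definition quasi_nilpotent (R : realType) (A : cstarAlgType R) (a : A) : Prop :=
  (complex.Re `|cpowS a n|) `^ (n.+1%:R^-1) @[n --> \oo] --> (0 : R).

(* Main.v *)
(* If [a + I] is central in [A / I], then each element in question lies in [I]:
   a central element [c] of a C*-algebra is normal, so it vanishes as soon as
   it is quasi-nilpotent.  For [c = [a, b]] central, iterating the derivation
   [[a, _]] on [b^n] gives [n! c^n] (Kleinecke-Shirokov); for [c = a b] central,
   [c^n = a^n b^n].  The C*-inequality [|x + I|^2 <= |x^* x + I|] in the
   quotient rests on [s |y| <= |(h + i s) y|] for [h] self-adjoint, which
   provides resolvents and, from them, an approximate unit of [I]. *)

Require Import Defs.
From mathcomp Require Import all_boot all_order all_algebra.
From mathcomp Require Import all_classical all_reals all_analysis.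
From mathcomp Require Import ring lra.

Set Implicit Arguments.
Unset Strict Implicit.
Unset Printing Implicit Defensive.

Import Order.TTheory GRing.Theory Num.Theory.
Import numFieldNormedType.Exports.

Local Open Scope classical_set_scope.
Local Open Scope ring_scope.
Local Open Scope complex_scope.
Local Open Scope cstar_scope.

(** * The real-valued norm of a C*-algebra and its completeness *)

Section CStarNorm.
Variables (R : realType) (A : cstarAlgType R).
Implicit Types (x y z h : A) (l : R[i]) (r s t e : R).

Definition cnorm x : R := complex.Re `|x|.

Lemma cnormE x : `|x| = (cnorm x)%:C.
Proof. by rewrite RRe_real ?ger0_real. Qed.

Lemma cnorm_ge0 x : 0 <= cnorm x.
Proof. by rewrite -ler0c -cnormE. Qed.

Lemma cnorm0 : cnorm 0 = 0.
Proof. by rewrite /cnorm normr0. Qed.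

Lemma cnorm_eq0 x : cnorm x = 0 -> x = 0.
Proof. by move=> x0; apply/normr0_eq0; rewrite cnormE x0. Qed.

Lemma ler_cnormD x y : cnorm (x + y) <= cnorm x + cnorm y.
Proof. by rewrite -lecR rmorphD /= -!cnormE ler_normD. Qed.

Lemma cnormN x : cnorm (- x) = cnorm x.
Proof. by rewrite /cnorm normrN. Qed.

Lemma cdistC x y : cnorm (x - y) = cnorm (y - x).
Proof. by rewrite -opprB cnormN. Qed.

Lemma ler_cnormB x y : cnorm (x - y) <= cnorm x + cnorm y.
Proof. by rewrite -(cnormN y) ler_cnormD. Qed.

Lemma cnormZ l x : cnorm (l *: x) = complex.Re `|l| * cnorm x.
Proof.
apply: complexI; rewrite -cnormE normrZ cnormE.
by rewrite -[in LHS](RRe_real (normr_real l)) rmorphM.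
Qed.

Lemma cnormZr r x : 0 <= r -> cnorm (r%:C *: x) = r * cnorm x.
Proof.
by move=> r0; rewrite cnormZ normc_def /= expr0n addr0 sqrtr_sqr ger0_norm.
Qed.

Lemma cnormZi r x : cnorm (r*i *: x) = `|r| * cnorm x.
Proof. by rewrite cnormZ normc_def /= expr0n add0r sqrtr_sqr. Qed.

Lemma cnorm_mul x y : cnorm (x ** y) <= cnorm x * cnorm y.
Proof. by rewrite -lecR rmorphM /= -!cnormE cnormM. Qed.

Lemma cnorm_sqr x : cnorm (cstar x ** x) = cnorm x ^+ 2.
Proof. by apply: complexI; rewrite rmorphXn /= -!cnormE cnorm_star_mul. Qed.

(** The C*-identity gives [|x|^2 = |x^* x| <= |x^*| |x|]; cancelling [|x|] yields one inequality,
    and applying it to [x^*] the other. *)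
Lemma cnorm_star x : cnorm (cstar x) = cnorm x.
Proof.
wlog suff le_star : x / cnorm x <= cnorm (cstar x).
  by apply/eqP; rewrite eq_le le_star andbT -{2}(cstarK x) le_star.
have [->|x0] := eqVneq (cnorm x) 0; first exact: cnorm_ge0.
have {}x0 : 0 < cnorm x by rewrite lt0r x0 cnorm_ge0.
by rewrite -(ler_pM2r x0) -expr2 -cnorm_sqr cnorm_mul.
Qed.

Lemma cmulNl x y : (- x) ** y = - (x ** y).
Proof. by rewrite -[- x]scaleN1r cmulZl scaleN1r. Qed.

Lemma cmulNr x y : x ** (- y) = - (x ** y).
Proof. by rewrite -[- y]scaleN1r cmulZr scaleN1r. Qed.

Lemma cmulBl x y z : (x - y) ** z = x ** z - y ** z.
Proof. by rewrite cmulDl cmulNl. Qed.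

Lemma cmulBr x y z : x ** (y - z) = x ** y - x ** z.
Proof. by rewrite cmulDr cmulNr. Qed.

Lemma cmul0l x : 0 ** x = 0.
Proof. by rewrite -{1}(subrr x) cmulBl subrr. Qed.

Lemma cmul0r x : x ** 0 = 0.
Proof. by rewrite -{1}(subrr x) cmulBr subrr. Qed.

Lemma cauchy_geometric (u : nat -> A) (C r : R) : 0 <= r < 1 ->
    (forall n, cnorm (u n.+1 - u n) <= C * r ^+ n) ->
  exists l : A, forall e, 0 < e -> \forall n \near \oo, cnorm (u n - l) < e.
Proof.
move=> /andP[r0 r1] ur.
have C0 : 0 <= C.
  by have := ur 0; rewrite mulr1; apply: le_trans; exact: cnorm_ge0.
have r1' : 0 < 1 - r by rewrite subr_gt0.
pose D := C / (1 - r).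
(* Keeping the exact partial geometric sum lets the induction on [m] telescope. *)
have uD n m : cnorm (u (n + m)%N - u n) <= D * (r ^+ n - r ^+ (n + m)%N).
  elim: m => [|m IH]; first by rewrite addn0 !subrr cnorm0 mulr0.
  have -> : u (n + m.+1)%N - u n =
      (u (n + m).+1%N - u (n + m)%N) + (u (n + m)%N - u n).
    by rewrite addnS addrA subrK.
  apply: (le_trans (ler_cnormD _ _)).
  apply: (le_trans (lerD (ur _) IH)).
  rewrite addnS exprS le_eqVlt; apply/orP; left; apply/eqP.
  by rewrite /D; field; rewrite gt_eqF.
have D0 : 0 <= D by rewrite divr_ge0 // ltW.
have {}uD n m : (n <= m)%N -> cnorm (u m - u n) <= D * r ^+ n.
  move=> nm; rewrite -(subnKC nm); apply: (le_trans (uD _ _)).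
  by rewrite ler_wpM2l // gerBl exprn_ge0.
have Dr e : 0 < e -> exists N, D * r ^+ N < e.
  move=> e0.
  have : D * r ^+ n @[n --> \oo] --> D * 0.
    apply: cvgMr; apply: cvg_expr; by rewrite ger0_norm.
  rewrite mulr0 => /cvgrPdist_lt /(_ e e0) [N _ /(_ N (leqnn N))] /=.
  rewrite sub0r normrN => h; exists N; apply: le_lt_trans h; exact: ler_norm.
have : cvgn u.
  apply/cauchy_cvgP; apply: cauchy_exP => e e0.
  have eE : e = (complex.Re e)%:C by rewrite RRe_real ?gtr0_real.
  have e0' : 0 < complex.Re e by rewrite -ltcR -eE.
  have [N hN] := Dr _ e0'.
  exists (u N); exists N => // n Nn.
  rewrite /= -ball_normE /= eE cnormE ltcR cdistC.
  exact: le_lt_trans (uD _ _ Nn) hN.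
move=> /cvg_ex[l ul]; exists l => e e0.
have e0' : 0 < e%:C :> R[i] by rewrite ltcR.
move/cvgrPdist_lt : ul => /(_ _ e0').
by apply: filterS => n; rewrite cnormE ltcR cdistC.
Qed.

(** Banach's fixed point argument on the iterates of [0]; it serves to solve the resolvent
    equation. *)
Lemma cnorm_contraction_fixpoint (G : A -> A) r : 0 <= r < 1 ->
  (forall x y, cnorm (G x - G y) <= r * cnorm (x - y)) -> exists x, G x = x.
Proof.
move=> r01 Gr; have /andP[r0 r1] := r01.
pose u n := iter n G 0.
have [|l ul] := @cauchy_geometric u (cnorm (G 0 - 0)) r r01.
  elim=> [|n IH]; first by rewrite mulr1.
  apply: (le_trans (Gr _ _)); rewrite exprS mulrCA.
  by rewrite ler_wpM2l.
exists l; apply/eqP; rewrite -subr_eq0; apply/eqP; apply: cnorm_eq0.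
apply/eqP; rewrite eq_le cnorm_ge0 andbT.
apply/ler_addgt0Pr => e e0; rewrite add0r.
have e0' : 0 < e / 2 by rewrite divr_gt0.
have [N _ hN] := ul _ e0'.
have -> : G l - l = (G l - G (u N)) + (u N.+1 - l) by rewrite addrA subrK.
apply: (le_trans (ler_cnormD _ _)); rewrite (splitr e); apply: lerD; last first.
  by apply: ltW; apply: hN => /=.
apply: (le_trans (Gr _ _)); rewrite cdistC.
apply: le_trans (ltW (hN N _)) => //=.
by rewrite ler_piMl ?cnorm_ge0 // ltW.
Qed.

End CStarNorm.

(** * Resolvents of self-adjoint elements without a unit *)

Section Resolvent.
Variables (R : realType) (A : cstarAlgType R).
Implicit Types (x y z h : A) (s t e : R).

(* [shiftl h s] and [shiftr h s] are the left multiplication by [h + i s] and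
   the right multiplication by [h - i s], taken in the unitization. *)
Definition shiftl h s y : A := h ** y + s*i *: y.
Definition shiftr h s y : A := y ** h - s*i *: y.

Lemma shiftlB h s x y : shiftl h s (x - y) = shiftl h s x - shiftl h s y.
Proof. by rewrite /shiftl cmulBr scalerBr opprD addrACA. Qed.

Lemma shiftrD h s x y : shiftr h s (x + y) = shiftr h s x + shiftr h s y.
Proof. by rewrite /shiftr cmulDl scalerDr opprD addrACA. Qed.

Lemma shiftrB h s x y : shiftr h s (x - y) = shiftr h s x - shiftr h s y.
Proof. by rewrite /shiftr cmulBl scalerBr !opprD opprK addrACA. Qed.

Lemma shiftlM h s x y : shiftl h s (x ** y) = shiftl h s x ** y.
Proof. by rewrite /shiftl cmulA cmulDl cmulZl. Qed.

Lemma shiftrM h s x y : shiftr h s (x ** y) = x ** shiftr h s y.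
Proof. by rewrite /shiftr -cmulA cmulBr cmulZr. Qed.

Lemma star_shiftl h s y : cstar h = h ->
  cstar (shiftl h s y) = shiftr h s (cstar y).
Proof.
move=> hh; rewrite /shiftl /shiftr cstarD cstarM cstarZ hh -scaleNr.
by congr (_ + _ *: _); apply/eqP; rewrite eq_complex /= oppr0 !eqxx.
Qed.

Lemma star_shiftr h s y : cstar h = h ->
  cstar (shiftr h s y) = shiftl h s (cstar y).
Proof.
by move=> hh; rewrite -(cstarK (shiftl _ _ _)) star_shiftl // cstarK.
Qed.

(** By the C*-identity it suffices to expand [y^* (h - i s) (h + i s) y]: the cross terms cancel and
    [(h y)^* (h y) + s^2 y^* y] remains. *)
Lemma sqr_cnorm_shiftl_le h s y : cstar h = h ->
  cnorm (shiftl h s y) ^+ 2 <= (cnorm h ^+ 2 + s ^+ 2) * cnorm y ^+ 2.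
Proof.
move=> hh; rewrite -cnorm_sqr star_shiftl //.
have -> : shiftr h s (cstar y) ** shiftl h s y =
    cstar (h ** y) ** (h ** y) + (s ^+ 2)%:C *: (cstar y ** y).
  rewrite /shiftr /shiftl cstarM hh cmulBl !cmulDr !cmulZl !cmulZr scalerA.
  rewrite cmulA opprD -!addrA; congr (_ + _).
  rewrite cmulA addrA subrr add0r -scaleNr; congr (_ *: _).
  by apply/eqP; rewrite eq_complex /=; apply/andP; split; apply/eqP; ring.
apply: (le_trans (ler_cnormD _ _)).
rewrite cnormZr ?sqr_ge0 // !cnorm_sqr mulrDl lerD2r -exprMn.
by rewrite ler_sqr ?nnegrE ?mulr_ge0 ?cnorm_ge0 // cnorm_mul.
Qed.

Lemma cnorm_shiftl_le h s y : cstar h = h ->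
  cnorm (shiftl h s y) <= Num.sqrt (cnorm h ^+ 2 + s ^+ 2) * cnorm y.
Proof.
move=> hh; rewrite -ler_sqr ?nnegrE ?mulr_ge0 ?sqrtr_ge0 ?cnorm_ge0 //.
rewrite exprMn sqr_sqrtr ?addr_ge0 ?sqr_ge0 //.
exact: sqr_cnorm_shiftl_le.
Qed.

(* Arens' trick: [h + i s = (h - i t) + i (s + t)], where the norm of [h - i t]
   is at most [sqrt (|h|^2 + t^2)], which is [t + O(1/t)] for large [t]. *)
Lemma cnorm_shiftl_ge h s y : cstar h = h ->
  s * cnorm y <= cnorm (shiftl h s y).
Proof.
move=> hh.
have key t : 0 < t ->
    (s - cnorm h ^+ 2 / (2 * t)) * cnorm y <= cnorm (shiftl h s y).
  move=> t0.
  have [st|st] := ltP (s + t) 0.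
    apply: le_trans (cnorm_ge0 _); rewrite mulr_le0_ge0 ?cnorm_ge0 //.
    have : 0 <= cnorm h ^+ 2 / (2 * t).
      by rewrite divr_ge0 ?sqr_ge0 // mulr_ge0 // ltW.
    by lra.
  have : cnorm ((s + t)*i *: y) <=
      cnorm (shiftl h s y) + cnorm (shiftl h (- t) y).
    have -> : (s + t)*i *: y = shiftl h s y - shiftl h (- t) y.
      rewrite /shiftl opprD addrACA subrr add0r -scaleNr -scalerDl.
      congr (_ *: _); apply/eqP.
      by rewrite eq_complex /= opprK oppr0 addr0 !eqxx.
    exact: ler_cnormB.
  (* Completing the square: [|h|^2 + t^2 <= (t + |h|^2 / (2 t))^2]. *)
  have /(le_trans (cnorm_shiftl_le _ _ hh)) :
      Num.sqrt (cnorm h ^+ 2 + (- t) ^+ 2) * cnorm y <=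
      (t + cnorm h ^+ 2 / (2 * t)) * cnorm y.
    rewrite ler_wpM2r ?cnorm_ge0 //.
    have p0 : 0 <= cnorm h ^+ 2 / (2 * t).
      by rewrite divr_ge0 ?sqr_ge0 // mulr_ge0 // ltW.
    rewrite -(@ger0_norm _ (t + _)) ?addr_ge0 ?(ltW t0) // -sqrtr_sqr.
    rewrite ler_wsqrtr //.
    have := sqr_ge0 (cnorm h ^+ 2 / (2 * t)).
    have : 2 * t * (cnorm h ^+ 2 / (2 * t)) = cnorm h ^+ 2.
      by field; rewrite gt_eqF.
    by set p := _ / _; nra.
  rewrite cnormZi ger0_norm //.
  set p := cnorm h ^+ 2 / _; nra.
apply/ler_addgt0Pr => e e0.
(* Chosen so that the error [|h|^2 |y| / (2 t)] is at most [e]; the [+ 1] keeps [t] positive. *)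
pose t := (cnorm h ^+ 2 * cnorm y) / (2 * e) + 1.
have t1 : 0 <= (cnorm h ^+ 2 * cnorm y) / (2 * e).
  by rewrite divr_ge0 ?mulr_ge0 ?sqr_ge0 ?cnorm_ge0 // ltW.
have t0 : 0 < t by rewrite ltr_pwDr.
have := key t t0; rewrite mulrBl lerBlDr => /le_trans; apply.
rewrite lerD2l mulrAC ler_pdivrMr ?mulr_gt0 //.
have -> : e * (2 * t) = cnorm h ^+ 2 * cnorm y + 2 * e.
  by rewrite /t; field; rewrite gt_eqF.
by rewrite lerDl mulr_ge0 // ltW.
Qed.

Lemma cnorm_shiftr_ge h s y : cstar h = h ->
  s * cnorm y <= cnorm (shiftr h s y).
Proof.
move=> hh; rewrite -(cnorm_star (shiftr _ _ _)) star_shiftr // -(cnorm_star y).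
exact: cnorm_shiftl_ge.
Qed.

Lemma shiftl_surj h s y : cstar h = h -> 0 < s -> exists z, shiftl h s z = y.
Proof.
move=> hh s0.
(* The ratio [r] below is less than 1 exactly when [|h|^2 < s^2 + 2 s t], and this [t] makes
   [|h|^2 = s t]. *)
pose t := cnorm h ^+ 2 / s.
have t0 : 0 <= t by rewrite divr_ge0 ?sqr_ge0 // ltW.
have st : 0 < s + t by rewrite ltr_pwDl.
pose r := Num.sqrt (cnorm h ^+ 2 + (- t) ^+ 2) / (s + t).
have r01 : 0 <= r < 1.
  rewrite divr_ge0 ?sqrtr_ge0 ?(ltW st) //= ltr_pdivrMr // mul1r.
  rewrite -(@ger0_norm _ (s + t)) ?(ltW st) // -sqrtr_sqr ltr_sqrt; last first.
    by rewrite exprn_gt0.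
  have -> : cnorm h ^+ 2 = s * t by rewrite /t mulrC divfK // gt_eqF.
  by nra.
pose k := (s + t)^-1.
have k0 : 0 <= k by rewrite invr_ge0 ltW.
have ik : k*i * (s + t)*i = -1.
  apply/eqP; rewrite eq_complex /=.
  by apply/andP; split; apply/eqP; rewrite /k; field; rewrite gt_eqF.
(* A fixed point solves the equation. Writing [h + i s = (h - i t) + i (s + t)], the second summand
   times [i k] cancels the identity, so [G] has linear part [i k (h - i t)]. *)
pose G z := z + k*i *: (shiftl h s z - y).
have [|z Gz] := @cnorm_contraction_fixpoint _ A G r r01.
  move=> z1 z2.
  have -> : G z1 - G z2 = k*i *: shiftl h (- t) (z1 - z2).
    rewrite /G opprD addrACA -scalerBr opprB [_ - y + _]addrA subrK -shiftlB.
    set z := z1 - z2.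
    have -> : shiftl h s z = shiftl h (- t) z + (s + t)*i *: z.
      rewrite /shiftl -addrA -scalerDl; congr (_ + _ *: _).
      by apply/eqP; rewrite eq_complex /= addr0 eqxx addrCA addNr addr0 eqxx.
    by rewrite scalerDr scalerA ik scaleN1r addrCA subrr addr0.
  rewrite cnormZi ger0_norm //.
  apply: (le_trans (ler_wpM2l k0 (cnorm_shiftl_le _ _ hh))).
  by rewrite mulrA /r /k [_^-1 * _]mulrC.
exists z; apply/eqP; rewrite -subr_eq0; apply/eqP.
have : k*i *: (shiftl h s z - y) = 0.
  by apply: (addrI z); rewrite addr0; exact: Gz.
move=> /(congr1 (fun u => (s + t)*i *: u)).
rewrite scaler0 scalerA mulrC ik scaleN1r => /eqP.
by rewrite oppr_eq0 => /eqP.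
Qed.

Lemma shiftr_surj h s y : cstar h = h -> 0 < s -> exists z, shiftr h s z = y.
Proof.
move=> hh s0; have [z zy] := shiftl_surj (cstar y) hh s0.
by exists (cstar z); rewrite -star_shiftl // zy cstarK.
Qed.

End Resolvent.

(** * The quotient seminorm of an ideal, and elements central modulo it *)

Section QuotientSeminorm.
Variables (R : realType) (A : cstarAlgType R) (I : set A).
Hypothesis idealI : closed_ideal I.
Implicit Types (x y z h a b c : A) (s t e r : R) (m n k : nat).

(** This is the norm of the coset [x + I], kept as a seminorm on [A] so that all computations use
    representatives. *)
Definition qnorm x : R := inf [set cnorm (x + i) | i in I].

Lemma idealN x : I x -> I (- x).
Proof. by rewrite -scaleN1r; exact: (idealZ idealI). Qed.

Lemma idealB x y : I x -> I y -> I (x - y).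
Proof. by move=> Ix Iy; apply: (idealD idealI) => //; exact: idealN. Qed.

Lemma has_inf_qnorm x : has_inf [set cnorm (x + i) | i in I].
Proof.
split; first by exists (cnorm (x + 0)), 0 => //; exact: (ideal0 idealI).
by exists 0 => _ [i _ <-]; exact: cnorm_ge0.
Qed.

Lemma qnorm_leD x i : I i -> qnorm x <= cnorm (x + i).
Proof. by move=> Ii; apply: ge_inf; [case: (has_inf_qnorm x)|exists i]. Qed.

Lemma qnorm_le x : qnorm x <= cnorm x.
Proof. by rewrite -{2}(addr0 x) qnorm_leD //; exact: (ideal0 idealI). Qed.

Lemma qnorm_glb x r : (forall i, I i -> r <= cnorm (x + i)) -> r <= qnorm x.
Proof.
move=> rx; apply: lb_le_inf; first by case: (has_inf_qnorm x).
by move=> _ [i Ii <-]; exact: rx.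
Qed.

Lemma qnorm_ge0 x : 0 <= qnorm x.
Proof. by apply: qnorm_glb => i _; exact: cnorm_ge0. Qed.

Lemma qnorm_eq x y : I (x - y) -> qnorm x = qnorm y.
Proof.
suff le_q u v : I (u - v) -> qnorm u <= qnorm v.
  by move=> Ixy; apply/eqP; rewrite eq_le !le_q // -opprB; exact: idealN.
move=> Iuv; apply: qnorm_glb => i Ii.
have -> : v + i = u + (i - (u - v)).
  by rewrite opprB addrCA [u + _]addrC subrK addrC.
by apply: qnorm_leD; exact: idealB.
Qed.

(** Elements [- i] of the ideal come arbitrarily close to [x], and [I] is closed. *)
Lemma qnorm_eq0 x : qnorm x = 0 -> I x.
Proof.
move=> x0; apply: (ideal_closed idealI) => B /nbhs_ballP[e /= e0 eB].
have e0' : 0 < complex.Re e by rewrite -ltcR RRe_real ?gtr0_real.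
have [_ [i Ii <-]] := inf_adherent e0' (has_inf_qnorm x).
rewrite -/(qnorm x) x0 add0r => xi.
exists (- i); split; first exact: idealN.
apply: eB; rewrite -ball_normE /= opprK cnormE -(RRe_real (gtr0_real e0)).
by rewrite ltcR.
Qed.

Lemma qnormMl x y : qnorm (x ** y) <= cnorm x * qnorm y.
Proof.
have [x0|x0] := eqVneq (cnorm x) 0.
  rewrite x0 mul0r (cnorm_eq0 x0) cmul0l.
  by rewrite (le_trans (qnorm_le _)) // cnorm0.
have {}x0 : 0 < cnorm x by rewrite lt0r x0 cnorm_ge0.
rewrite -ler_pdivrMl //; apply: qnorm_glb => i Ii.
rewrite ler_pdivrMl //; apply: le_trans (cnorm_mul _ _).
by rewrite cmulDr; apply: qnorm_leD; exact: (idealMl idealI).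
Qed.

Lemma qnormZ r x : 0 < r -> r * qnorm x <= qnorm (r%:C *: x).
Proof.
move=> r0; apply: qnorm_glb => i Ii.
have rE : i = r%:C *: (r^-1%:C *: i).
  by rewrite scalerA -rmorphM /= divff ?gt_eqF // scale1r.
rewrite rE -scalerDr cnormZr ?(ltW r0) // ler_pM2l //.
by apply: qnorm_leD; exact: (idealZ idealI).
Qed.

(* As [s] tends to [0], the element [e = (h - i s)^-1 h] of the ideal, where
   [h = i^* i], plays the role of an approximate unit: [x - x e = - i s z] with
   [z = x (h - i s)^-1], and [i - i e] tends to [0]. *)
Lemma qnorm_sqr x : qnorm x ^+ 2 <= qnorm (cstar x ** x).
Proof.
apply: qnorm_glb => i Ii; set k := _ + i; pose h := cstar i ** i.
have hh : cstar h = h by rewrite /h cstarM cstarK.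
have Ih : I h by exact: (idealMl idealI).
(* The error [d] is of order [sqrt s]; taking [s = e^2 / 2] makes it at most [e]. *)
suff bound s : 0 < s ->
    exists2 d, d ^+ 2 <= 2 * s & qnorm x ^+ 2 <= cnorm k + d.
  apply/ler_addgt0Pr => e e0.
  have [|d d2 qd] := bound (e ^+ 2 / 2); first by rewrite divr_gt0 // exprn_gt0.
  apply: (le_trans qd); rewrite lerD2l.
  move: d2; rewrite mulrC divfK // => d2.
  have [d0|d0] := ltP d 0; first by rewrite (le_trans (ltW d0)) ?ltW.
  by rewrite -ler_sqr ?nnegrE // ltW.
move=> s0; have s0' := ltW s0.
have [z zx] := shiftr_surj x hh s0.
have [n ni] := shiftr_surj i hh s0.
exists (s * cnorm n).
  (* Here [m = h (h - i s)^-1]. Multiplying [m^* m - m^*] by [h - i s] on the right leaves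
     [i s m^*], whence [|m^* m - m^*| <= |m^*|] and [|m|^2 <= 2 |m|]. *)
  have m_le : cnorm (cstar i ** n) <= 2.
    set m := _ ** n.
    have rm : shiftr h s m = h by rewrite shiftrM ni.
    have : s * cnorm (cstar m ** m - cstar m) <= s * cnorm (cstar m).
      apply: (le_trans (cnorm_shiftr_ge _ _ hh)).
      rewrite shiftrB shiftrM rm /shiftr opprB addrCA subrr addr0.
      by rewrite cnormZi ger0_norm.
    rewrite ler_pM2l // => mm.
    have : cnorm (cstar m ** m) <= 2 * cnorm (cstar m).
      rewrite -(subrK (cstar m) (cstar m ** m)) (le_trans (ler_cnormD _ _)) //.
      by rewrite mulr_natl mulr2n lerD2r.
    rewrite cnorm_sqr cnorm_star expr2.
    have [->|m0] := eqVneq (cnorm m) 0; first by [].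
    by rewrite ler_pM2r // lt0r m0 cnorm_ge0.
  (* Since [(h + i s) n^* = i^*], the lower bound for [shiftl] applies to [n^* n]; with [m_le] it
     gives [s |n|^2 <= 2]. *)
  have : s * cnorm (cstar n ** n) <= cnorm (cstar i ** n).
    rewrite -ni star_shiftr // -shiftlM; exact: cnorm_shiftl_ge.
  rewrite cnorm_sqr exprMn; move: m_le; set u := cnorm (_ ** _) => u2 su.
  by nra.
have qz : qnorm x <= s * cnorm z.
  have -> : s * cnorm z = cnorm (x - z ** h).
    by rewrite -{1}zx /shiftr addrAC subrr add0r cnormN cnormZi ger0_norm.
  by apply: qnorm_leD; apply: idealN; exact: (idealMl idealI).
have zxz : s * cnorm z ^+ 2 <= cnorm (cstar x ** z).
  rewrite -cnorm_sqr -zx star_shiftr // -shiftlM; exact: cnorm_shiftl_ge.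
(* Multiplying [x^* z + n] by [h - i s] on the right gives [x^* x + i], that is [k]. *)
have xzn : s * cnorm (cstar x ** z + n) <= cnorm k.
  apply: (le_trans (cnorm_shiftr_ge _ _ hh)).
  by rewrite shiftrD shiftrM zx ni.
apply: (@le_trans _ _ ((s * cnorm z) ^+ 2)).
  by rewrite ler_sqr ?nnegrE ?mulr_ge0 ?qnorm_ge0 ?cnorm_ge0.
have xz : cnorm (cstar x ** z) <= cnorm (cstar x ** z + n) + cnorm n.
  by rewrite -{1}(addrK n (cstar x ** z)) ler_cnormB.
rewrite exprMn expr2 -mulrA.
apply: (le_trans (ler_wpM2l s0' zxz)).
apply: (le_trans (ler_wpM2l s0' xz)).
by rewrite mulrDr lerD2r.
Qed.

Definition central_mod c := forall x, I (c ** x - x ** c).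

Lemma eqmod_trans y x z : I (x - y) -> I (y - z) -> I (x - z).
Proof.
by move=> xy yz; rewrite -(subrK y x) -addrA; exact: (idealD idealI).
Qed.

Lemma eqmod_sym x y : I (x - y) -> I (y - x).
Proof. by move=> xy; rewrite -opprB; exact: idealN. Qed.

Lemma eqmodM x x' y y' : I (x - x') -> I (y - y') -> I (x ** y - x' ** y').
Proof.
move=> xx yy; apply: (@eqmod_trans (x' ** y)).
  by rewrite -cmulBl; exact: (Defs.idealMr idealI).
by rewrite -cmulBr; exact: (idealMl idealI).
Qed.

Lemma eqmod_refl x : I (x - x).
Proof. by rewrite subrr; exact: (ideal0 idealI). Qed.

Lemma central_modM c c' : central_mod c -> central_mod c' ->
  central_mod (c ** c').
Proof.
move=> hc hc' x; apply: (@eqmod_trans (c ** x ** c')).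
  by rewrite -!cmulA; apply: eqmodM => //; exact: eqmod_refl.
by rewrite cmulA; apply: eqmodM => //; exact: eqmod_refl.
Qed.

Lemma central_mod_cpowS c n : central_mod c -> central_mod (cpowS c n).
Proof. by move=> hc; elim: n => //= n IH; exact: central_modM. Qed.

Lemma cpowSD (x : A) m n : cpowS x m ** cpowS x n = cpowS x (m + n).+1.
Proof. by elim: m => //= m IH; rewrite -cmulA IH. Qed.

Lemma cpowS_star (x : A) n : cstar (cpowS x n) = cpowS (cstar x) n.
Proof.
elim: n => //= n IH; rewrite cstarM IH.
by have := cpowSD (cstar x) n 0; rewrite addn0.
Qed.

Lemma cnorm_cpowS_le (x : A) n : cnorm (cpowS x n) <= cnorm x ^+ n.+1.
Proof.
elim: n => // n IH; apply: (le_trans (cnorm_mul _ _)).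
by rewrite exprS ler_wpM2l ?cnorm_ge0.
Qed.

(** The index [(2 ^ m).-1] encodes the power [x^(2^m)], because [cpowS] is shifted by one. *)
Lemma cpowS_double (x : A) m :
  cpowS x (2 ^ m).-1 ** cpowS x (2 ^ m).-1 = cpowS x (2 ^ m.+1).-1.
Proof.
rewrite cpowSD; congr cpowS.
rewrite expnS mul2n -addnn; case: (2 ^ m)%N (expn_gt0 2 m) => //= k _.
by rewrite addnS.
Qed.

(** Each power of [h] is self-adjoint, so [qnorm_sqr] can be iterated along repeated squaring. *)
Lemma qnorm_pow2 h m : cstar h = h ->
  qnorm h ^+ (2 ^ m) <= qnorm (cpowS h (2 ^ m).-1).
Proof.
move=> hh; elim: m => // m IH.
rewrite expnSr exprM.
apply: (@le_trans _ _ (qnorm (cpowS h (2 ^ m).-1) ^+ 2)).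
  by rewrite ler_sqr ?nnegrE ?exprn_ge0 ?qnorm_ge0.
by apply: (le_trans (qnorm_sqr _)); rewrite cpowS_star hh cpowS_double expnSr.
Qed.

(** In the inductive step the central factor [x y] moves past the power of [x], where its two
    letters join the two powers. *)
Lemma cpowSM_mod x y n : central_mod (x ** y) ->
  I (cpowS (x ** y) n - cpowS x n ** cpowS y n).
Proof.
move=> hxy; elim: n => [|n IH] /=; first exact: eqmod_refl.
apply: (@eqmod_trans (x ** y ** (cpowS x n ** cpowS y n))).
  by apply: eqmodM IH; exact: eqmod_refl.
have -> : x ** cpowS x n = cpowS x n ** x.
  by have := cpowSD x n 0; rewrite addn0.
have -> : cpowS x n ** x ** (y ** cpowS y n) =
  cpowS x n ** (x ** y) ** cpowS y n by rewrite !cmulA.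
by rewrite cmulA; apply: eqmodM; [exact: hxy|exact: eqmod_refl].
Qed.

Lemma central_mod_radical c : central_mod c ->
  (forall e, 0 < e -> \forall n \near \oo, qnorm (cpowS c n) <= e ^+ n.+1) ->
  I c.
Proof.
move=> hc cn; apply: qnorm_eq0; apply/eqP; apply: contraT => q0.
have {}q0 : 0 < qnorm c by rewrite lt0r q0 qnorm_ge0.
have c0 : 0 < cnorm c by exact: lt_le_trans (qnorm_le _).
(* This makes [|c| e] half of [qnorm c ^+ 2], which contradicts the comparison of the two bounds. *)
pose e := qnorm c ^+ 2 / (2 * cnorm c).
have e0 : 0 < e by rewrite divr_gt0 ?exprn_gt0 ?mulr_gt0.
have [N _ hN] := cn _ e0.
have N2 : (N <= (2 ^ N).-1)%N by rewrite -ltnS prednK ?expn_gt0 // ltn_expl.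
have {}hN : qnorm (cpowS c (2 ^ N).-1) <= e ^+ (2 ^ N).
  by have := hN _ N2; rewrite /= prednK ?expn_gt0.
have star_pow n : I (cpowS (cstar c ** c) n - cpowS (cstar c) n ** cpowS c n).
  elim: n => [|n IH] /=; first exact: eqmod_refl.
  apply: (@eqmod_trans (cstar c ** c ** (cpowS (cstar c) n ** cpowS c n))).
    by apply: eqmodM IH; exact: eqmod_refl.
  rewrite -!cmulA; apply: eqmodM; first exact: eqmod_refl.
  by rewrite !cmulA; apply: eqmodM; [exact: hc|exact: eqmod_refl].
have hh : cstar (cstar c ** c) = cstar c ** c by rewrite cstarM cstarK.
have : (qnorm c ^+ 2) ^+ (2 ^ N) <= (cnorm c * e) ^+ (2 ^ N).
  apply: (@le_trans _ _ (qnorm (cstar c ** c) ^+ (2 ^ N))).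
    by rewrite lerXn2r ?nnegrE ?exprn_ge0 ?qnorm_ge0 // qnorm_sqr.
  apply: (le_trans (qnorm_pow2 _ hh)); rewrite (qnorm_eq (star_pow _)).
  apply: (le_trans (qnormMl _ _)).
  rewrite exprMn ler_pM ?cnorm_ge0 ?qnorm_ge0 //.
  apply: (le_trans (cnorm_cpowS_le _ _)).
  by rewrite prednK ?expn_gt0 // cnorm_star.
have -> : cnorm c * e = qnorm c ^+ 2 / 2 by rewrite /e; field; rewrite gt_eqF.
have p0 : 0 < qnorm c ^+ 2 by rewrite exprn_gt0.
rewrite ler_pXn2r ?expn_gt0 // ?nnegrE ?divr_ge0 ?(ltW p0) //.
by lra.
Qed.

End QuotientSeminorm.

(** * Commutators, quasi-nilpotent elements and their multiples that are central modulo an ideal *)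

Section CentralElements.
Variables (R : realType) (A : cstarAlgType R) (I : set A).
Hypothesis idealI : closed_ideal I.
Implicit Types (x y a b c : A) (e : R) (m n k : nat).

Lemma qnorm_iter_cmul b n y :
  qnorm I (iter n (cmul b) y) <= cnorm b ^+ n * qnorm I y.
Proof.
elim: n => [|n IH]; first by rewrite mul1r.
apply: (le_trans (qnormMl idealI _ _)).
by rewrite exprS -mulrA ler_wpM2l ?cnorm_ge0.
Qed.

Lemma qnorm_commutator_le a y :
  qnorm I (ccommutator a y) <= 2 * cnorm a * qnorm I y.
Proof.
have [a0|a0] := eqVneq (cnorm a) 0.
  rewrite /ccommutator (cnorm_eq0 a0) cmul0l cmul0r subrr.
  by rewrite (le_trans (qnorm_le idealI _)) // cnorm0 mulr0 mul0r.
have {}a0 : 0 < 2 * cnorm a by rewrite mulr_gt0 // lt0r a0 cnorm_ge0.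
rewrite -ler_pdivrMl //; apply: (qnorm_glb idealI) => i Ii.
rewrite ler_pdivrMl //.
apply: (@le_trans _ _ (cnorm (ccommutator a (y + i)))).
  have -> : ccommutator a (y + i) = ccommutator a y + ccommutator a i.
    by rewrite /ccommutator cmulDr cmulDl opprD addrACA.
  apply: (qnorm_leD idealI); apply: (idealB idealI).
    exact: (Defs.idealMl idealI).
  exact: (Defs.idealMr idealI).
apply: (le_trans (ler_cnormB _ _)).
apply: (le_trans (lerD (cnorm_mul _ _) (cnorm_mul _ _))).
by rewrite [cnorm (_ + _) * _]mulrC -mulrDl mulr_natl mulr2n.
Qed.

(** Leibniz' rule for the derivation [[a, _]]: each of the [n + 1] factors [b] contributes a [c],
    which is central modulo [I]. The seed [y] makes sense of [b^0] without a unit. *)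
Lemma commutator_iter_mod a b n y :
    central_mod I (ccommutator a b) -> I (ccommutator a y) ->
  I (ccommutator a (iter n.+1 (cmul b) y)
     - n.+1%:R *: iter n (cmul b) (ccommutator a b ** y)).
Proof.
set c := ccommutator a b => hc ay.
have leib w : ccommutator a (b ** w) = c ** w + b ** ccommutator a w.
  by rewrite /c /ccommutator cmulBl cmulBr !cmulA addrA subrK.
have c_iter k : I (c ** iter k (cmul b) y - iter k (cmul b) (c ** y)).
  elim: k => [|k IH] /=; first exact: (eqmod_refl idealI).
  apply: (eqmod_trans idealI (y := b ** (c ** iter k (cmul b) y))).
    rewrite !cmulA; apply: (eqmodM idealI); first exact: hc.
    exact: (eqmod_refl idealI).
  by apply: (eqmodM idealI) => //; exact: (eqmod_refl idealI).
elim: n => [|n IH].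
  rewrite /= leib scale1r addrAC subrr add0r.
  exact: (Defs.idealMl idealI).
rewrite iterS leib.
set w := iter n.+1 _ _; set v := n.+1%:R *: _ in IH.
have -> : n.+2%:R *: iter n.+1 (cmul b) (c ** y) =
    iter n.+1 (cmul b) (c ** y) + b ** v.
  by rewrite /v cmulZr -[n.+2]add1n natrD scalerDl scale1r.
rewrite opprD addrACA; apply: (Defs.idealD idealI); first exact: c_iter.
by rewrite -cmulBr; exact: (Defs.idealMl idealI).
Qed.

(** One application of [[a, _]] trades a factor [b] of [b^(n+1) c^(k+1)] for [(n + 1) c], at a cost
    of [2 |a|]. The index [k] is general because the induction raises it. *)
Lemma qnorm_central_commutator a b n k :
    central_mod I (ccommutator a b) ->
  n`!%:R * qnorm I (cpowS (ccommutator a b) (n + k)) <=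
  (2 * cnorm a) ^+ n * qnorm I (iter n (cmul b) (cpowS (ccommutator a b) k)).
Proof.
set c := ccommutator a b => hc.
elim: n k => [|n IH] k; first by rewrite !mul1r.
rewrite factS mulnC natrM [_ * n.+1%:R]mulrC -mulrA addSnnS.
apply: (le_trans (ler_wpM2l (ler0n _ _) (IH _))).
rewrite mulrCA exprSr -mulrA ler_wpM2l ?exprn_ge0 ?mulr_ge0 ?cnorm_ge0 //.
apply: le_trans (qnorm_commutator_le _ _).
have ck : I (ccommutator a (cpowS c k)).
  apply: (eqmod_sym idealI).
  exact: (central_mod_cpowS idealI k hc).
rewrite (qnorm_eq idealI (commutator_iter_mod n hc ck)).
have -> : n.+1%:R = n.+1%:R%:C :> R[i] by rewrite rmorph_nat.
by apply: (qnormZ idealI); rewrite ltr0n.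
Qed.

Lemma central_commutator_mod a b : central_mod I (ccommutator a b) ->
  I (ccommutator a b).
Proof.
set c := ccommutator a b => hc.
apply: (central_mod_radical idealI hc) => e e0.
pose K := 2 * cnorm a * cnorm b.
have q0 : 0 < qnorm I c + 1 by rewrite ltr_wpDl // (qnorm_ge0 idealI).
have e1 : 0 < e / (qnorm I c + 1) by rewrite divr_gt0.
(* The terms [(K / e)^n / n!] of the exponential series tend to [0], so [K^n / n!] is eventually
   below any multiple of [e^n]. The [+ 1] in the threshold avoids division by zero. *)
have /cvgrPdist_lt/(_ _ e1) := @cvg_exp_coeff R (K / e).
apply: filterS => n; rewrite sub0r normrN /exp_coeff /= => hn.
have {hn} := le_lt_trans (ler_norm _) hn.
rewrite ltr_pdivlMr // => hn.
have nf : 0 < n`!%:R :> R by rewrite ltr0n fact_gt0.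
rewrite -(ler_pM2l nf).
have := qnorm_central_commutator n 0 hc; rewrite addn0 => /le_trans; apply.
apply: (@le_trans _ _ (K ^+ n * qnorm I c)).
  rewrite /K [in leRHS]exprMn -[leRHS]mulrA.
  rewrite ler_wpM2l ?exprn_ge0 ?mulr_ge0 ?cnorm_ge0 //.
  exact: qnorm_iter_cmul.
have Kn : 0 <= K ^+ n by rewrite exprn_ge0 // !mulr_ge0 ?cnorm_ge0.
apply: (@le_trans _ _ (K ^+ n * (qnorm I c + 1))).
  by rewrite ler_wpM2l // lerDl.
have -> : K ^+ n = n`!%:R * e ^+ n * ((K / e) ^+ n / n`!%:R).
  by rewrite expr_div_n; field; rewrite expf_neq0 ?gt_eqF.
rewrite -[leLHS]mulrA exprSr [leRHS]mulrA.
rewrite ler_wpM2l ?mulr_ge0 ?exprn_ge0 ?(ltW nf) ?(ltW e0) //.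
exact: ltW.
Qed.

Lemma quasi_nilpotent_near a e : quasi_nilpotent a -> 0 < e ->
  \forall n \near \oo, cnorm (cpowS a n) <= e ^+ n.+1.
Proof.
move=> /cvgrPdist_lt qa e0; apply: filterS (qa e e0) => n.
rewrite sub0r normrN => /(le_lt_trans (ler_norm _)) hn.
have -> : cnorm (cpowS a n) = (cnorm (cpowS a n) `^ n.+1%:R^-1) ^+ n.+1.
  by rewrite -powR_mulrn ?powR_ge0 // -powRrM mulVf // powRr1 ?cnorm_ge0.
by rewrite ler_pXn2r ?nnegrE ?powR_ge0 ?(ltW e0) // ltW.
Qed.

Lemma quasi_nilpotent_central_mod a : quasi_nilpotent a -> central_mod I a ->
  I a.
Proof.
move=> qa ha; apply: (central_mod_radical idealI ha) => e e0.
apply: filterS (quasi_nilpotent_near qa e0) => n.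
exact: le_trans (qnorm_le idealI _).
Qed.

Lemma quasi_nilpotent_near_mul a b e : quasi_nilpotent a -> 0 < e ->
  \forall n \near \oo, cnorm (cpowS a n) * cnorm (cpowS b n) <= e ^+ n.+1.
Proof.
move=> qa e0.
have b0 : 0 < cnorm b + 1 by rewrite ltr_wpDl // cnorm_ge0.
have e1 : 0 < e / (cnorm b + 1) by rewrite divr_gt0.
apply: filterS (quasi_nilpotent_near qa e1) => n an.
have -> : e ^+ n.+1 = (e / (cnorm b + 1)) ^+ n.+1 * (cnorm b + 1) ^+ n.+1.
  by rewrite -exprMn divfK // gt_eqF.
apply: ler_pM => //; rewrite ?cnorm_ge0 //.
apply: (le_trans (cnorm_cpowS_le _ _)).
by rewrite ler_pXn2r ?nnegrE ?cnorm_ge0 ?(ltW b0) // lerDl.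
Qed.

(** Modulo [I], [(a b)^n] is [a^n b^n], and the geometric growth of one factor is absorbed by the
    decay of the other. *)
Lemma quasi_nilpotent_mul_central_mod a b :
  quasi_nilpotent a \/ quasi_nilpotent b -> central_mod I (a ** b) ->
  I (a ** b).
Proof.
move=> qab hab; apply: (central_mod_radical idealI hab) => e e0.
have : \forall n \near \oo, cnorm (cpowS a n) * cnorm (cpowS b n) <= e ^+ n.+1.
  case: qab => q; first exact: quasi_nilpotent_near_mul.
  apply: filterS (quasi_nilpotent_near_mul a q e0) => n.
  by rewrite mulrC.
apply: filterS => n; apply: le_trans.
rewrite (qnorm_eq idealI (cpowSM_mod idealI n hab)).
exact: le_trans (qnorm_le idealI _) (cnorm_mul _ _).
Qed.

Lemma quot_center_central_mod a : quot_center I (ccoset I a) -> central_mod I a.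
Proof.
move=> [_ ha] x.
have := ha (ccoset I x); rewrite !quot_mul_coset // => /(_ _).
have Yx : cquotient I (ccoset I x) by exists x.
move=> /(_ Yx) axa.
(* The equality of cosets is tested on the single representative [a ** x]. *)
have : ccoset I (a ** x) (a ** x).
  by exists 0; [exact: (Defs.ideal0 idealI)|rewrite addr0].
by rewrite axa => -[i Ii <-]; rewrite addrAC subrr add0r.
Qed.

End CentralElements.

(** * From membership in ideals to CQ-elements, with [0] as the central summand *)

Lemma central_mod_CQ (R : realType) (A : cstarAlgType R) (a : A) :
    (forall I : set A, closed_ideal I -> central_mod I a -> I a) ->
  CQ A a.
Proof.
move=> ha I idealI /(quot_center_central_mod idealI) /(ha _ idealI) Ia.
exists 0, a; split=> //; last by rewrite add0r.
by move=> x; rewrite cmul0l cmul0r.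
Qed.

Lemma closed_ideal0 (R : realType) (A : cstarAlgType R) :
  closed_ideal [set (0 : A)].
Proof.
split=> //=.
- by move=> x y -> ->; rewrite addr0.
- by move=> l x ->; rewrite scaler0.
- by move=> x y ->; rewrite cmul0r.
- by move=> x y ->; rewrite cmul0l.
- apply: accessible_closed_set1; apply: hausdorff_accessible.
  exact: norm_hausdorff.
Qed.

Theorem proposition4p5 (R : realType) (A : cstarAlgType R) :
  ((forall a b : A, CQ A (ccommutator a b)) /\
   (CQ A = ccenter A <-> cabelian A)) /\
  ((forall a : A, quasi_nilpotent a -> CQ A a) /\
   (forall a : A, quasi_nilpotent a ->
      forall b : A, CQ A (a ** b) /\ CQ A (b ** a))).
Proof.
have CQ_comm (a b : A) : CQ A (ccommutator a b).
  by apply: central_mod_CQ => I idealI; exact: central_commutator_mod.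
split; last split.
- split; first exact: CQ_comm.
  split=> [CQZ x y|abA].
    have Zc : ccenter A (ccommutator x y) by rewrite -CQZ.
    apply/eqP; rewrite -subr_eq0; apply/eqP.
    (* Modulo the zero ideal, a central commutator lies in that ideal, hence vanishes. *)
    apply: (central_commutator_mod (closed_ideal0 A)) => w /=.
    by rewrite /= Zc subrr.
  apply/seteqP; split=> a _; first by move=> x; exact: abA.
  move=> I idealI _; exists a, 0; split; last by rewrite addr0.
  - by move=> x; exact: abA.
  - exact: (Defs.ideal0 idealI).
- move=> a qa; apply: central_mod_CQ => I idealI.
  exact: quasi_nilpotent_central_mod.
- move=> a qa b; split; apply: central_mod_CQ => I idealI.
    by apply: quasi_nilpotent_mul_central_mod => //; left.
  by apply: quasi_nilpotent_mul_central_mod => //; right.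
Qed.
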